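(* Let $R$ be a ring and $I$ an ideal of $R$. (1) $V(I)$ and $V_M(I)$ have the P.A-property for $R$. In particular, if $M$ is a finitely generated $R$-module, then $\mathrm{supp}(M)$ has the P.A-property. (2) Let $\mathcal{A}\subseteq \mathrm{Spec}(R)$ be a set which does not have the P.A-property for $R$. Then there exists a prime ideal $Q\notin \mathcal{A}$ such that $\bigcap_{P\in \mathcal{A}} P \subseteq Q$. (3) Let $\mathcal{A}\subseteq \mathrm{Spec}(R)$ and let $I$ be an ideal of $R$ such that $I\subseteq \bigcup_{P\in \mathcal{A}} P$. Then either there exists a prime ideal $P$ in $\mathcal{A}$ such that $I\subseteq P$, or $\mathcal{A}\subsetneq V(\mathrm{Ann}(I))$. Hence in the latter case $I+\mathrm{Ann}(I)$ is a proper ideal of $R$. (4) Let $\mathcal{A}\subseteq \mathrm{Spec}(R)$ and let $\mathcal{A}'$ be the set of ideals $I$ of $R$ which are contained in $\bigcup_{P\in \mathcal{A}} P$ but satisfy $I\nsubseteq P$ for each $P\in \mathcal{A}$. Then either $\mathcal{A}$ has the P.A-property or $\mathcal{A}\subsetneq V(I')$, where $I'=\sum_{I\in \mathcal{A}'} \mathrm{Ann}(I)$. (5) If $R$ is a zero-dimensional ring and $\mathcal{A}\subseteq \mathrm{Spec}(R)$ is compact, then $\mathcal{A}$ has the P.A-property for $R$.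
   Context: All rings are commutative with $1\neq 0$. A set $\mathcal{A}\subseteq \mathrm{Spec}(R)$ has the P.A-property (prime avoidance property) for $R$ if whenever an ideal $J$ of $R$ satisfies $J\subseteq\bigcup_{P\in\mathcal{A}}P$, there exists $P\in\mathcal{A}$ with $J\subseteq P$. For an ideal $I$, $V(I)$ is the set of prime ideals of $R$ containing $I$ and $V_M(I)$ is the set of maximal ideals of $R$ containing $I$. $\mathrm{Ann}(I)$ is the annihilator of $I$ in $R$, and $\mathrm{supp}(M)=\{P\in\mathrm{Spec}(R)\mid M_P\neq 0\}$. Zero-dimensional means Krull dimension zero (every prime ideal is maximal). Subsets $\mathcal{A}$ of $\mathrm{Spec}(R)$ carry the subspace topology of the Zariski topology; compact means every open cover has a finite subcover (no Hausdorff condition). *)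

(* Defs.v *)
From HB Require Import structures.
From mathcomp Require Import all_boot all_order all_algebra.
From mathcomp Require Import generic_quotient ring_quotient ring.
From mathcomp Require Import boolp classical_sets topology.

Set Implicit Arguments.
Unset Strict Implicit.
Unset Printing Implicit Defensive.

Import GRing.Theory.

Local Open Scope ring_scope.
Local Open Scope classical_set_scope.
Local Open Scope quotient_scope.

(* Subsets of R are classical sets; [in I] is the boolean predicate expected
   by the closure conditions of the algebra library. *)

(* The ideals of R, including R itself, are the submodules of R^o.  The
   library's [idealr_closed] only describes the proper ideals. *)
Definition ideal (R : comNzRingType) (I : set R) : Prop :=
  submod_closed ([in I] : {pred R^o}).

Definition prime_ideal (R : comNzRingType) (P : set R) : Prop :=
  idealr_closed [in P] /\ prime_idealr_closed [in P].

Definition maximal_ideal (R : comNzRingType) (I : set R) : Prop :=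
  [/\ ideal I, I != setT
    & forall J : set R, ideal J -> I `<=` J -> J = I \/ J = setT].

Lemma idealP (R : comNzRingType) (I : set R) :
  ideal I <-> [/\ I 0, (forall x y, I x -> I y -> I (x + y))
                 & forall a x, I x -> I (a * x)].
Proof.
split=> [[I0 Il]|[I0 ID IM]].
  split=> [|x y Ix Iy|a x Ix]; first exact: set_mem I0.
    by have := Il 1 x y (mem_set Ix) (mem_set Iy); rewrite scale1r => /set_mem.
  by have := Il a x 0 (mem_set Ix) I0; rewrite addr0 => /set_mem.
split=> [|a x y /set_mem Ix /set_mem Iy]; apply: mem_set => //.
exact/ID/Iy/IM.
Qed.

Lemma prime_idealP (R : comNzRingType) (P : set R) :
  prime_ideal P <->
  [/\ ideal P, ~ P 1 & forall x y, P (x * y) -> P x \/ P y].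
Proof.
split=> [[[P0 P1 Pl] Pp]|[[P0 Pl] P1 Pp]].
  split; [by split | by move/mem_set; apply/negP | move=> x y /mem_set /Pp].
  by case/orP=> /set_mem; [left|right].
split; first by split=> //; apply/negP => /set_mem.
by move=> x y /set_mem /Pp [] /mem_set ->; rewrite ?orbT.
Qed.

Record spec (R : comNzRingType) := Spec {
  spec_set :> set R;
  spec_prime : prime_ideal spec_set }.

HB.instance Definition _ (R : comNzRingType) := gen_eqMixin (spec R).
HB.instance Definition _ (R : comNzRingType) := gen_choiceMixin (spec R).

Definition V (R : comNzRingType) (E : set R) : set (spec R) :=
  [set P : spec R | E `<=` P].

(* Nothing is lost by asking for elements of [spec R]: maximal ideals are
   prime, see [maximal_prime]. *)
Definition VM (R : comNzRingType) (E : set R) : set (spec R) :=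
  [set P : spec R | maximal_ideal P /\ E `<=` P].

Lemma maximal_prime (R : comNzRingType) (I : set R) :
  maximal_ideal I -> prime_ideal I.
Proof.
case=> Iid /eqP IT Imax; have /idealP[I0 ID IM] := Iid.
have I1 : ~ I 1.
  move=> I1; apply: IT; apply/seteqP; split=> // x _.
  by rewrite -[x]mulr1; exact: IM.
apply/prime_idealP; split=> // x y Ixy.
have [|Ix] := pselect (I x); [by left | right].
pose J : set R := [set a + b * x | a in I & b in setT].
have Jid : ideal J.
  apply/idealP; split.
  - by exists 0 => //; exists 0 => //; rewrite mul0r addr0.
  - move=> _ _ [a Ia [b _ <-]] [c Ic [d _ <-]].
    exists (a + c); first exact: ID.
    by exists (b + d) => //; rewrite mulrDl addrACA.
  - move=> r _ [a Ia [b _ <-]]; exists (r * a); first exact: IM.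
    by exists (r * b) => //; rewrite mulrDr mulrA.
have [|JI|JT] := Imax J Jid.
- by move=> a Ia; exists a => //; exists 0 => //; rewrite mul0r addr0.
- case: Ix; rewrite -JI; exists 0 => //.
  by exists 1 => //; rewrite mul1r add0r.
have : J 1 by rewrite JT.
case=> a Ia [b _ ab1]; rewrite -[y]mul1r -ab1 mulrDl.
by apply: ID; [rewrite mulrC | rewrite -mulrA]; exact: IM.
Qed.

Section Zariski.
Variable R : comNzRingType.

(* The sets V(E), for E an arbitrary subset of R, are the V(I) for I an ideal. *)
Definition zariski_open : set_system (spec R) :=
  [set U | exists E : set R, U = ~` V E].

Let zariski_openT : zariski_open setT.
Proof.
exists setT; apply/esym/seteqP; split=> // P _ /(_ 1 I).
by have /prime_idealP[] := spec_prime P.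
Qed.

Let zariski_openI : setI_closed zariski_open.
Proof.
move=> _ _ [E ->] [F ->]; exists [set x * y | x in E & y in F].
rewrite -setCU; congr (~` _); apply/seteqP; split=> P /=.
  have /prime_idealP[/idealP[_ _ PM] _ _] := spec_prime P.
  case=> [EP|FP] _ [x Ex [y Fy <-]]; last exact/PM/FP.
  by rewrite mulrC; exact/PM/EP.
have /prime_idealP[_ _ Pp] := spec_prime P.
move=> EFP; have [|/existsNP[x /not_implyP[Ex Px]]] := pselect (E `<=` P).
  by left.
right=> y Fy; have [] // : spec_set P x \/ spec_set P y.
by apply/Pp/EFP; exists x => //; exists y.
Qed.

Let zariski_open_bigU (T : Type) (f : T -> set (spec R)) :
  (forall i, zariski_open (f i)) -> zariski_open (\bigcup_i f i).
Proof.
move=> /choice[E fE]; exists (\bigcup_i E i).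
under eq_bigcupr do rewrite fE.
rewrite -setC_bigcap; congr (~` _); apply/seteqP; split=> P.
  by move=> EP x [i _ Eix]; exact: (EP i).
by move=> EP i _ x Eix; apply: EP; exists i.
Qed.

HB.instance Definition _ := isOpenTopological.Build (spec R)
  zariski_openT zariski_openI zariski_open_bigU.

End Zariski.

Definition has_PA (R : comNzRingType) (A : set (spec R)) : Prop :=
  forall J : set R, ideal J -> J `<=` \bigcup_(P in A) P ->
    exists2 P, A P & J `<=` P.

Definition zero_dimensional_ring (R : comNzRingType) : Prop :=
  forall P : set R, prime_ideal P -> maximal_ideal P.

Definition Ann (R : comNzRingType) (I : set R) : set R :=
  [set a | forall x, I x -> a * x = 0].

Definition ideal_add (R : comNzRingType) (I J : set R) : set R :=
  [set x + y | x in I & y in J].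

(* The sum of the ideals F t, t ranging over D: all finite sums of elements of
   their union; it is the zero ideal when D is empty. *)
Definition ideal_sum (R : comNzRingType) (T : Type) (D : set T)
    (F : T -> set R) : set R :=
  [set x | exists (n : nat) (t : 'I_n -> T) (a : 'I_n -> R),
     (forall i, D (t i) /\ F (t i) (a i)) /\ x = \sum_(i < n) a i].

Definition fin_gen (R : comNzRingType) (M : lmodType R) : Prop :=
  exists (n : nat) (g : 'I_n -> M), forall m : M,
    exists c : 'I_n -> R, m = \sum_(i < n) c i *: g i.

(* Localization of a module at a prime: fractions m / s with s outside P, where
   m / s = m' / s' when u (s' m - s m') = 0 for some u outside P. *)
Section Localization.
Variables (R : comNzRingType) (M : lmodType R) (P : spec R).

Definition denom := {s : R | s \notin (P : set R)}.

HB.instance Definition _ := Choice.on denom.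

Definition den (s : denom) : R := sval s.
Arguments den : simpl never.

Implicit Types (s t : denom) (x y z : M * denom).

Let denomP s : ~ spec_set P (den s).
Proof. by move/mem_set; apply/negP/(valP s). Qed.

Let denom1_subproof : (1 : R) \notin (P : set R).
Proof. by apply/negP => /set_mem; have /prime_idealP[] := spec_prime P. Qed.

Definition denom1 : denom := exist _ 1 denom1_subproof.

Let denomM_subproof s t : den s * den t \notin (P : set R).
Proof.
apply/negP => /set_mem; have /prime_idealP[_ _ Pp] := spec_prime P.
by case/Pp => /denomP.
Qed.

Definition denomM s t : denom := exist _ (den s * den t) (denomM_subproof s t).

Let den1 : den denom1 = 1. Proof. by []. Qed.

Let denM s t : den (denomM s t) = den s * den t. Proof. by []. Qed.

Definition loc_equiv x y : bool :=
  `[< exists u : denom,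
        den u *: (den y.2 *: x.1 - den x.2 *: y.1) = 0 >].

Lemma loc_equiv_refl : reflexive loc_equiv.
Proof. by move=> x; apply/asboolP; exists denom1; rewrite subrr scaler0. Qed.

Lemma loc_equiv_sym : symmetric loc_equiv.
Proof.
suff H x y : loc_equiv x y -> loc_equiv y x by move=> x y; apply/idP/idP; exact: H.
move=> /asboolP[u e]; apply/asboolP; exists u.
by rewrite -opprB scalerN e oppr0.
Qed.

Lemma loc_equiv_trans : transitive loc_equiv.
Proof.
move=> y x z /asboolP[u e] /asboolP[v f]; apply/asboolP.
exists (denomM (denomM u v) y.2); rewrite !denM.
transitivity
  ((den v * den z.2) *: (den u *: (den y.2 *: x.1 - den x.2 *: y.1)) +
   (den u * den x.2) *: (den v *: (den z.2 *: y.1 - den y.2 *: z.1))); last first.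
  by rewrite e f !scaler0 addr0.
rewrite !scalerBr !scalerA addrA.
rewrite (_ : den v * den z.2 * den u * den x.2 =
             den u * den x.2 * den v * den z.2); last by ring.
by rewrite subrK; congr (_ *: _ - _ *: _); ring.
Qed.

Canonical loc_equiv_rel :=
  EquivRel loc_equiv loc_equiv_refl loc_equiv_sym loc_equiv_trans.

Definition localization := {eq_quot loc_equiv}.

HB.instance Definition _ : EqQuotient _ loc_equiv localization :=
  EqQuotient.on localization.
HB.instance Definition _ := Choice.on localization.

Lemma loc_eqP x y : x = y %[mod localization] <->
  exists u : denom, den u *: (den y.2 *: x.1 - den x.2 *: y.1) = 0.
Proof.
by split=> [/eqmodP/asboolP //|e]; apply/eqmodP/asboolP.
Qed.

Let reprE x : exists u : denom,
  den u *: (den x.2 *: (repr (\pi_localization x)).1 -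
            den (repr (\pi_localization x)).2 *: x.1) = 0.
Proof. by apply/loc_eqP; rewrite reprK. Qed.

Definition loc_zerof : M * denom := (0, denom1).
Definition loc_addf x y : M * denom :=
  (den y.2 *: x.1 + den x.2 *: y.1, denomM x.2 y.2).
Definition loc_oppf x : M * denom := (- x.1, x.2).
Definition loc_scalef (a : R) x : M * denom := (a *: x.1, x.2).

Definition loc_zero : localization := lift_cst localization loc_zerof.
Definition loc_add := lift_op2 localization loc_addf.
Definition loc_opp := lift_op1 localization loc_oppf.
Definition loc_scale (a : R) := lift_op1 localization (loc_scalef a).

Canonical pi_loc_zero_morph := PiConst loc_zero.

Lemma pi_loc_add : {morph \pi : x y / loc_addf x y >-> loc_add x y}.
Proof.
move=> x y; unlock loc_add; apply/esym/loc_eqP => /=.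
have [u e] := reprE x; have [v f] := reprE y.
move: (repr _) e (repr _) f => x' e y' f; exists (denomM u v); rewrite /= !denM.
transitivity
  ((den v * den y.2 * den y'.2) *: (den u *: (den x.2 *: x'.1 - den x'.2 *: x.1)) +
   (den u * den x.2 * den x'.2) *: (den v *: (den y.2 *: y'.1 - den y'.2 *: y.1)));
  last by rewrite e f !scaler0 addr0.
rewrite !(scalerBr, scalerDr) !scalerA opprD addrACA.
by congr (_ *: _ - _ *: _ + (_ *: _ - _ *: _)); ring.
Qed.
Canonical pi_loc_add_morph := PiMorph2 pi_loc_add.

Lemma pi_loc_opp : {morph \pi : x / loc_oppf x >-> loc_opp x}.
Proof.
move=> x; unlock loc_opp; apply/esym/loc_eqP => /=.
have [u e] := reprE x; exists u.
by rewrite !scalerN -opprD scalerN e oppr0.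
Qed.
Canonical pi_loc_opp_morph := PiMorph1 pi_loc_opp.

Lemma pi_loc_scale a : {morph \pi : x / loc_scalef a x >-> loc_scale a x}.
Proof.
move=> x; unlock loc_scale; apply/esym/loc_eqP => /=.
have [u e] := reprE x; exists u.
transitivity (a *: (den u *: (den x.2 *: (repr (\pi_localization x)).1 -
                              den (repr (\pi_localization x)).2 *: x.1))).
  rewrite !scalerBr !scalerA.
  by congr (_ *: _ - _ *: _); ring.
by rewrite e scaler0.
Qed.
Canonical pi_loc_scale_morph a := PiMorph1 (pi_loc_scale a).

Let eq_num_den x y : x.1 = y.1 -> den x.2 = den y.2 -> x = y.
Proof. by case: x y => [m s] [n t] /= -> /val_inj ->. Qed.

Let addA : associative loc_add.
Proof.
elim/quotW=> x; elim/quotW=> y; elim/quotW=> z; rewrite !piE; congr (\pi _).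
apply: eq_num_den; rewrite /= !denM; last by rewrite mulrA.
rewrite !scalerDr !scalerA addrA.
by congr (_ *: _ + _ *: _ + _ *: _); ring.
Qed.

Let addC : commutative loc_add.
Proof.
elim/quotW=> x; elim/quotW=> y; rewrite !piE; congr (\pi _).
by apply: eq_num_den; rewrite /= ?denM; [rewrite addrC | rewrite mulrC].
Qed.

Let add0 : left_id loc_zero loc_add.
Proof.
elim/quotW=> x; rewrite !piE; congr (\pi _).
by apply: eq_num_den; rewrite /= ?denM den1 ?mul1r // scaler0 scale1r add0r.
Qed.

Let addN : left_inverse loc_zero loc_opp loc_add.
Proof.
elim/quotW=> x; rewrite !piE; apply/loc_eqP; exists denom1 => /=.
by rewrite scalerN addNr !scaler0 subrr scaler0.
Qed.

HB.instance Definition _ :=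
  GRing.isZmodule.Build localization addA addC add0 addN.

Let scaleA a b v : loc_scale a (loc_scale b v) = loc_scale (a * b) v.
Proof.
elim/quotW: v => x; rewrite !piE; congr (\pi _).
by apply: eq_num_den => //=; rewrite scalerA.
Qed.

Let scale1 : left_id 1 loc_scale.
Proof.
elim/quotW=> x; rewrite !piE; congr (\pi _).
by apply: eq_num_den => //=; rewrite scale1r.
Qed.

Let scaleDr : right_distributive loc_scale +%R.
Proof.
move=> a; elim/quotW=> x; elim/quotW=> y; rewrite !piE; congr (\pi _).
by apply: eq_num_den => //=; rewrite scalerDr !scalerA ![a * _]mulrC.
Qed.

Let scaleDl v : {morph loc_scale^~ v : a b / a + b}.
Proof.
move=> a b; elim/quotW: v => x; rewrite !piE; apply/loc_eqP; exists denom1 => /=.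
by rewrite denM -scalerDr -scalerDl !scalerA subrr scaler0.
Qed.

HB.instance Definition _ :=
  GRing.Zmodule_isLmodule.Build R localization scaleA scale1 scaleDr scaleDl.

End Localization.

Definition supp (R : comNzRingType) (M : lmodType R) : set (spec R) :=
  [set P : spec R | exists x : localization M P, x != 0].

(* Main.v *)
Require Import Defs.
From HB Require Import structures.
From mathcomp Require Import all_boot all_order all_algebra.
From mathcomp Require Import finmap generic_quotient ring.
From mathcomp Require Import boolp classical_sets topology.

Set Implicit Arguments.
Unset Strict Implicit.
Unset Printing Implicit Defensive.

Import GRing.Theory.

Local Open Scope ring_scope.
Local Open Scope classical_set_scope.

(** Except for compactness, everything comes from one remark: an ideal J
    covered by the primes of A stays proper after adding any ideal K contained
    in all the primes of A.  Indeed, if 1 = j + k, a prime of A that contains j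
    also contains k, hence 1 ([ideal_add_proper]).  So some maximal ideal Q
    contains both J and K ([exists_maximal_above]).

    - If VM(I) <= A <= V(I), take K = I: then Q lies in A and contains J.
      This covers V(I) and VM(I), and supp M too, because the support of a
      finitely generated module is V(Ann M) ([supp_V]).
    - If J lies in no prime of A, then Q is outside A.  With K the
      intersection of A, this is a prime outside A above that intersection,
      and it makes every inclusion A <= V(K) strict ([uncovered_proper]).
      The inclusions in the statements about annihilators hold because a
      prime P not containing I contains Ann(I): if x is in I but not in P,
      then a x = 0 forces a into P ([V_Ann]).

    Let now A be compact in the spectrum of a zero-dimensional ring, and suppose
    that the covered ideal J is contained in no prime of A.  The sets
    D(x) = [P | x notin P], for x in J, then cover A, so by compactness
    finitely many of them do.  In a zero-dimensional ring a finitely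
    generated ideal has the same radical as one of its elements z
    ([zero_dimensional_radical]); here z is in J, hence in some P of A, which
    then contains all the chosen x: a contradiction.  For two generators x, y,
    one finds r such that every prime contains x or 1 - r x
    ([zero_dimensional_split]); no prime contains both, and
    z = x + (1 - r x) y works.

    Maximal ideals, and the primes needed to find r, are produced by Zorn's
    lemma as ideals maximal among those disjoint from a given set
    ([ideal_maximal_disjoint]). *)

(** * Operations on ideals *)

Section Ideals.
Variable R : comNzRingType.
Implicit Types (I J K S : set R) (A : set (spec R)) (P Q : spec R) (x y : R).

Lemma spec_ideal P : ideal P.
Proof. by have /prime_idealP[] := spec_prime P. Qed.

Lemma ideal_bigcap A : ideal (\bigcap_(P in A) P).
Proof.
apply/idealP; split=> [P _|x y Ax Ay P AP|a x Ax P AP];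
  have /idealP[P0 PD PM] := spec_ideal P => //.
  by apply: PD; [exact: Ax|exact: Ay].
by apply: PM; exact: Ax.
Qed.

Lemma ideal_Ann I : ideal (Ann I).
Proof.
apply/idealP; split=> [x _|x y Ix Iy z Iz|a x Ix z Iz]; first by rewrite mul0r.
  by rewrite mulrDl Ix // Iy // addr0.
by rewrite -mulrA Ix // mulr0.
Qed.

Lemma ideal_ideal_add I J : ideal I -> ideal J -> ideal (ideal_add I J).
Proof.
move=> /idealP[I0 ID IM] /idealP[J0 JD JM]; apply/idealP; split.
- by exists 0 => //; exists 0 => //; rewrite addr0.
- move=> _ _ [a Ia [b Jb <-]] [c Ic [d Jd <-]].
  exists (a + c); first exact: ID.
  by exists (b + d); [exact: JD|rewrite addrACA].
- move=> r _ [a Ia [b Jb <-]]; exists (r * a); first exact: IM.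
  by exists (r * b); [exact: JM|rewrite mulrDr].
Qed.

Lemma sub_ideal_addl I J : ideal J -> I `<=` ideal_add I J.
Proof.
by move=> /idealP[J0 _ _] x Ix; exists x => //; exists 0; rewrite ?addr0.
Qed.

Lemma sub_ideal_addr I J : ideal I -> J `<=` ideal_add I J.
Proof.
by move=> /idealP[I0 _ _] x Jx; exists 0 => //; exists x; rewrite ?add0r.
Qed.

Definition principal x : set R := [set a * x | a in setT].

Lemma ideal_principal x : ideal (principal x).
Proof.
apply/idealP; split; first by exists 0; rewrite ?mul0r.
  by move=> _ _ [a _ <-] [b _ <-]; exists (a + b); rewrite ?mulrDl.
by move=> c _ [a _ <-]; exists (c * a); rewrite ?mulrA.
Qed.

Lemma principal_id x : principal x x.
Proof. by exists 1; rewrite ?mul1r. Qed.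

Lemma ideal_properP I : ideal I -> I != setT <-> ~ I 1.
Proof.
move=> /idealP[I0 ID IM]; split=> [/eqP IT I1|I1]; last first.
  by apply/eqP => IT; apply: I1; rewrite IT.
by apply: IT; apply/seteqP; split=> // x _; rewrite -[x]mulr1; exact: IM.
Qed.

(** * Maximal and prime ideals from Zorn's lemma *)

(** Common source of maximal ideals (S = {1}) and of primes avoiding a
    multiplicative set: disjointness from S passes to unions of chains. *)
Lemma ideal_maximal_disjoint S J : ideal J -> J `&` S = set0 ->
  exists Q : set R, [/\ ideal Q, J `<=` Q, Q `&` S = set0 &
    forall K, ideal K -> Q `<` K -> K `&` S !=set0].
Proof.
move=> Jid JS.
pose good K := [/\ ideal K, J `<=` K & K `&` S = set0].
(* The union of the empty chain is empty, so set0 has to be admitted; it is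
   not maximal, being strictly below J. *)
have [|Q [Qgood Qmax]] := @Zorn_bigcup R [set K | K = set0 \/ good K].
  move=> F Fgood Ftot.
  have [[K0 FK0 K0good]|Fno] := pselect (exists2 K, F K & good K); last first.
    left; apply: bigcup0 => K FK; have [//|Kgood] := Fgood K FK.
    by case: Fno; exists K.
  right; split.
  - apply/idealP; split.
    + by exists K0 => //; have [/idealP[]] := K0good.
    + move=> x y [K FK Kx] [L FL Ly].
      have both M : F M -> M x -> M y -> (\bigcup_(X in F) X) (x + y).
        move=> FM Mx My; exists M => //.
        have [M0|[/idealP[_ MD _] _ _]] := Fgood M FM; last exact: MD.
        by rewrite M0 in Mx.
      have [KL|LK] := Ftot K L FK FL; first exact: (both L FL (KL _ Kx) Ly).
      exact: (both K FK Kx (LK _ Ly)).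
    + move=> a x [K FK Kx]; exists K => //.
      have [K0e|[/idealP[_ _ KM] _ _]] := Fgood K FK; last exact: KM.
      by rewrite K0e in Kx.
  - by move=> x Jx; exists K0 => //; have [_ JK _] := K0good; exact: JK.
  - rewrite setI_bigcupl; apply: bigcup0 => K FK.
    by have [->|[_ _]//] := Fgood K FK; rewrite set0I.
have J0 : J 0 by have /idealP[] := Jid.
case: Qgood => [Q0|[Qid JQ QS]].
  have QJ : Q `<` J by rewrite Q0; split=> // /(_ 0 J0).
  by case: (Qmax J QJ); right; split.
exists Q; split=> // K Kid QK; apply/set0P/eqP => KS.
apply: (Qmax K QK); right; split=> //.
by move=> x Jx; case: QK => + _; apply; exact: JQ.
Qed.

Lemma exists_maximal_ideal J : ideal J -> ~ J 1 ->
  exists2 Q : spec R, maximal_ideal Q & J `<=` Q.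
Proof.
move=> Jid J1.
have [|Q [Qid JQ Q1 Qmax]] := @ideal_maximal_disjoint [set 1] J Jid.
  by apply/seteqP; split=> // x [Jx x1]; apply: J1; rewrite -x1.
have mQ : maximal_ideal Q.
  split=> //.
    apply/(ideal_properP Qid) => Q_1.
    by have : (Q `&` [set 1]) 1 by []; rewrite Q1.
  move=> K Kid QK; have [KQ|nKQ] := pselect (K `<=` Q).
    by left; apply/seteqP.
  right; have [|k [Kk k1]] := Qmax K Kid; first by split.
  by apply: contrapT => /eqP /(ideal_properP Kid); rewrite -k1.
by exists (Spec (maximal_prime mQ)).
Qed.

(** If x and y are outside an ideal Q maximal among those disjoint from S, then
    Q + (x) and Q + (y) meet S, and the product of the two meeting points lies
    in S and in Q + (x y); hence x y is outside Q. *)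
Lemma exists_prime_disjoint S : S 1 -> (forall s t, S s -> S t -> S (s * t)) ->
  ~ S 0 -> exists P, P `&` S = set0.
Proof.
move=> S1 SM S0.
have id0 : ideal [set 0 : R].
  by apply/idealP; split=> // [x y -> ->|a x ->]; rewrite ?addr0 ?mulr0.
have [|Q [Qid _ QS Qmax]] := @ideal_maximal_disjoint S _ id0.
  by apply/seteqP; split=> // x [->].
have disj s : S s -> ~ Q s.
  by move=> Ss Qs; have : (Q `&` S) s by []; rewrite QS.
have /idealP[Q0 QD QM] := Qid.
suff Qp : prime_ideal Q by exists (Spec Qp).
apply/prime_idealP; split=> //; first exact: disj.
move=> x y Qxy; apply: contrapT => /not_orP[Qx Qy].
have meet z : ~ Q z -> ideal_add Q (principal z) `&` S !=set0.
  move=> Qz; have prz := ideal_principal z.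
  apply: Qmax; first exact: ideal_ideal_add.
  split; first exact: sub_ideal_addl.
  by move=> addQ; apply/Qz/addQ/(sub_ideal_addr Qid)/principal_id.
have [s [[q Qq [_ [a _ <-] es]] Ss]] := meet x Qx.
have [t [[p Qp [_ [b _ <-] et]] St]] := meet y Qy.
apply: (disj _ (SM _ _ Ss St)); rewrite -es -et.
have -> : (q + a * x) * (p + b * y) =
    (p + b * y) * q + ((a * x) * p + (a * b) * (x * y)) by ring.
by apply/QD; [exact: QM|apply: QD; exact: QM].
Qed.

(** * Ideals covered by a set of primes *)

(** A prime of A containing the J-component of 1 contains its K-component as
    well, hence 1. *)
Lemma ideal_add_proper A J K : J `<=` \bigcup_(P in A) P -> A `<=` V K ->
  ~ ideal_add J K 1.
Proof.
move=> JA AK [j Jj [k Kk jk1]]; have [P AP Pj] := JA j Jj.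
have /prime_idealP[/idealP[_ PD _] P1 _] := spec_prime P.
by apply: P1; rewrite -jk1; apply: PD => //; exact: AK Kk.
Qed.

Lemma exists_maximal_above A J K : ideal J -> ideal K ->
  J `<=` \bigcup_(P in A) P -> A `<=` V K ->
  exists Q, [/\ maximal_ideal Q, J `<=` Q & K `<=` Q].
Proof.
move=> Jid Kid JA AK.
have [Q mQ JKQ] :=
  exists_maximal_ideal (ideal_ideal_add Jid Kid) (ideal_add_proper JA AK).
exists Q; split=> // x ?; apply: JKQ; first exact: sub_ideal_addl.
exact: sub_ideal_addr.
Qed.

Lemma has_PA_between I A : ideal I -> VM I `<=` A -> A `<=` V I -> has_PA A.
Proof.
move=> Iid IA AI J Jid JA.
have [Q [mQ JQ IQ]] := exists_maximal_above Jid Iid JA AI.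
by exists Q => //; apply: IA.
Qed.

(** A maximal ideal above J and the intersection of A lies in V(K) and, since it
    contains J, cannot be in A. *)
Lemma uncovered_proper A J K : ideal J -> J `<=` \bigcup_(P in A) P ->
  (forall P, A P -> ~ J `<=` P) -> A `<=` V K -> A `<` V K.
Proof.
move=> Jid JA JnP AK; split=> // KA.
have AI : A `<=` V (\bigcap_(P in A) P) by move=> P AP x; apply.
have [Q [_ JQ capQ]] := exists_maximal_above Jid (@ideal_bigcap A) JA AI.
apply: (JnP Q) => //; apply: KA => x Kx.
by apply: capQ => P AP; exact: AK Kx.
Qed.

Lemma not_has_PAP A : ~ has_PA A -> exists J,
  [/\ ideal J, J `<=` \bigcup_(P in A) P & forall P, A P -> ~ J `<=` P].
Proof.
move=> /existsNP[J /not_implyP[Jid /not_implyP[JA nJ]]]; exists J; split=> //.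
by move=> P AP JP; apply: nJ; exists P.
Qed.

Lemma V_Ann I P : ~ I `<=` P -> V (Ann I) P.
Proof.
move=> /existsNP[x /not_implyP[Ix Px]] a aI.
have /prime_idealP[/idealP[P0 _ _] _ Pp] := spec_prime P.
by have [|//|/Px//] := Pp a x; rewrite aI.
Qed.

(** * Zero-dimensional rings *)

(** The elements x^n (1 - r x) form a multiplicative set.  If it avoided 0, a
    prime P would avoid it; then x (n = 1, r = 0) is not in P, so x is invertible modulo the
    maximal ideal P, that is, some 1 - a x is in P, which n = 0 excludes.  Hence
    x^n (1 - r x) = 0 for some n and r, and this r serves all primes. *)
Lemma zero_dimensional_split x : zero_dimensional_ring R ->
  exists r, forall P, spec_set P x \/ spec_set P (1 - r * x).
Proof.
move=> dim0.
pose S := [set x ^+ n * (1 - r * x) | n in @setT nat & r in @setT R].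
have [[n _ [r _ e]]|S0] := pselect (S 0); last first.
  have [|_ _ [n _ [r _ <-]] [m _ [s _ <-]]||P PS] := @exists_prime_disjoint S.
  - by exists 0%N => //; exists 0 => //; ring.
  - exists (n + m)%N => //; exists (r + s - r * s * x) => //.
    by rewrite exprD; ring.
  - exact: S0.
  have disj s : S s -> ~ spec_set P s.
    by move=> Ss Ps; have : (P `&` S) s by []; rewrite PS.
  have Px : ~ spec_set P x.
    by apply: disj; exists 1%N => //; exists 0 => //; ring.
  have [Pid _ Pmax] := dim0 P (spec_prime P).
  have prx := ideal_principal x.
  have [|PQ|PT] := Pmax _ (ideal_ideal_add Pid prx).
  - exact: sub_ideal_addl.
  - by case: Px; rewrite -PQ; exact/(sub_ideal_addr Pid)/principal_id.
  - have : ideal_add P (principal x) 1 by rewrite PT.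
    move=> [p Pp [_ [a _ <-] pe]]; case: (disj (1 - a * x)).
      by exists 0%N => //; exists a => //; rewrite expr0 mul1r.
    by rewrite -pe addrK.
exists r => P.
have /prime_idealP[/idealP[P0 _ _] P1 Pp] := spec_prime P.
have [|Pn|] := Pp (x ^+ n) (1 - r * x); [by rewrite e| |by right].
left; elim: n Pn {e} => [/P1//|n IH].
by rewrite exprS => /Pp[|/IH].
Qed.

(** Induction on the generators: if y does for s, then x + (1 - r x) y does for
    x :: s, with r as in [zero_dimensional_split].  For a prime P containing this
    element, x is in P (clear if 1 - r x is), so r x y is, and therefore y. *)
Lemma zero_dimensional_radical J (s : seq R) : zero_dimensional_ring R ->
  ideal J -> (forall x, x \in s -> J x) ->
  exists2 z, J z & forall P, spec_set P z -> forall x, x \in s -> spec_set P x.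
Proof.
move=> dim0 /idealP[J0 JD JM]; elim: s => [|x s IH] Js; first by exists 0.
have [y Jy yP] : exists2 y, J y &
    forall P, spec_set P y -> forall x, x \in s -> spec_set P x.
  by apply: IH => y ys; apply: Js; rewrite in_cons ys orbT.
have [r rP] := zero_dimensional_split x dim0.
exists (x + (1 - r * x) * y) => [|P Pz].
  by apply: JD; [apply: Js; exact: mem_head|exact: JM].
have /prime_idealP[/idealP[_ PD PM] P1 _] := spec_prime P.
have Px : spec_set P x.
  have [//|Prx] := rP P.
  have -> : x = (x + (1 - r * x) * y) + (- y) * (1 - r * x) by ring.
  by apply: PD => //; exact: PM.
have Py : spec_set P y.
  have -> : y = (x + (1 - r * x) * y) + (r * y - 1) * x by ring.
  by apply: PD => //; exact: PM.
by move=> w; rewrite in_cons => /orP[/eqP->//|]; exact: yP.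
Qed.

Lemma zero_dimensional_compact_PA A : zero_dimensional_ring R ->
  cover_compact A -> has_PA A.
Proof.
move=> dim0 cA J Jid JA; apply: contrapT => nJ.
have [x _|P AP|s sJ sA] := cA R J (fun x => ~` V [set x]).
- by exists [set x].
- have /existsNP[x /not_implyP[Jx Px]] : ~ J `<=` P.
    by move=> ?; apply: nJ; exists P.
  by exists x => //; move=> /(_ x erefl).
have [|z Jz zP] := @zero_dimensional_radical J (enum_fset s) dim0 Jid.
  by move=> x xs; exact/set_mem/sJ.
have [P AP Pz] := JA z Jz; have [x xs] := sA P AP; apply=> _ ->.
exact: zP xs.
Qed.

End Ideals.

(** * The support of a finitely generated module *)

Section Support.
Variables (R : comNzRingType) (M : lmodType R).

Lemma localization_neq0 (P : spec R) (x : M * denom P) :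
  (\pi_(localization M P) x != 0)%qT <->
  forall u : R, ~ spec_set P u -> u *: x.1 != 0.
Proof.
have -> : (0 : localization M P) =
    \pi_(localization M P)%qT (loc_zerof M P) by rewrite piE.
split=> [/eqP xn0 u Pu|xn0].
  apply/eqP => ux0; apply: xn0; apply/loc_eqP.
  have Pu' : u \notin (P : set R) by apply/negP => /set_mem.
  by exists (exist _ u Pu'); rewrite /= scaler0 subr0 scale1r.
apply/eqP => /loc_eqP[u]; rewrite /= scaler0 subr0 scale1r => e.
have Pu : ~ spec_set P (den u) by move/mem_set; apply/negP/(valP u).
by move: (xn0 _ Pu); rewrite e eqxx.
Qed.

Definition mod_Ann : set R := [set a | forall m : M, a *: m = 0].

Lemma ideal_mod_Ann : ideal mod_Ann.
Proof.
apply/idealP; split=> [m|a b Ha Hb m|a b Hb m]; first by rewrite scale0r.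
  by rewrite scalerDl Ha Hb addr0.
by rewrite -scalerA Hb scaler0.
Qed.

(** If each of the finitely many generators is killed by some u i outside P, the
    product of the u i kills M and is still outside P. *)
Lemma supp_V : fin_gen M -> supp M = V mod_Ann.
Proof.
move=> [n [g gP]]; apply/seteqP; split=> P.
  move=> [x]; elim/quotW: x => x /localization_neq0 xn0 a aM.
  by apply: contrapT => /xn0; rewrite aM eqxx.
move=> MP; apply: contrapT => PM.
have /prime_idealP[_ P1 Pp] := spec_prime P.
have kill (m : M) : exists u, ~ spec_set P u /\ u *: m = 0.
  apply: contrapT => /forallNP mP; apply: PM.
  exists (\pi_(localization M P)%qT (m, denom1 P)).
  apply/localization_neq0 => u Pu /=; apply/eqP => e.
  by apply: (mP u).
have [u uP] := choice (fun i => kill (g i)).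
have : ~ spec_set P (\prod_(i < n) u i).
  by elim/big_ind: _ => // [a b Pa Pb /Pp[]//|i _]; exact: (uP i).1.
apply; apply: MP => m; have [c ->] := gP m.
rewrite scaler_sumr big1 // => i _.
by rewrite scalerA (bigD1 i) //= mulrC mulrCA mulrC -!scalerA (uP i).2 !scaler0.
Qed.

End Support.

Theorem proposition2p1 (R : comNzRingType) :
  (forall I : set R, ideal I -> has_PA (V I) /\ has_PA (VM I)) /\
  (forall M : lmodType R, fin_gen M -> has_PA (supp M)) /\
  (forall A : set (spec R), ~ has_PA A ->
     exists Q : spec R, ~ A Q /\ \bigcap_(P in A) P `<=` Q) /\
  (forall (A : set (spec R)) (I : set R), ideal I ->
     I `<=` \bigcup_(P in A) P ->
     ((exists P : spec R, A P /\ I `<=` P) \/ A `<` V (Ann I)) /\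
     (A `<` V (Ann I) ->
        ideal (ideal_add I (Ann I)) /\ ideal_add I (Ann I) <> setT)) /\
  (forall A : set (spec R),
     let A' := [set I : set R | [/\ ideal I, I `<=` \bigcup_(P in A) P
                                  & forall P : spec R, A P -> ~ I `<=` P]] in
     let I' := ideal_sum A' (@Ann R) in
     has_PA A \/ A `<` V I') /\
  (zero_dimensional_ring R ->
     forall A : set (spec R), cover_compact A -> has_PA A).
Proof.
split; last split; last split; last split; last split.
- move=> I Iid; split; apply: (has_PA_between Iid) => // P []; tauto.
- move=> M /supp_V ->.
  by apply: (has_PA_between (ideal_mod_Ann M)) => // P []; tauto.
- move=> A /not_has_PAP[J [Jid JA JnP]].
  have [|_ /existsNP[Q /not_implyP[capQ AQ]]] :=
    uncovered_proper (K := \bigcap_(P in A) P) Jid JA JnP; last by exists Q.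
  by move=> P AP x; apply.
- move=> A I Iid IA; split; last first.
    move=> [AV _]; have addid := ideal_ideal_add Iid (ideal_Ann I).
    split=> //; apply/eqP/(ideal_properP addid).
    exact: ideal_add_proper AV.
  have [|nI] := pselect (exists P : spec R, A P /\ I `<=` P); [by left|right].
  have InP P : A P -> ~ I `<=` P by move=> AP IP; apply: nI; exists P.
  by apply: (uncovered_proper Iid IA InP) => P AP; apply/V_Ann/InP.
- move=> A A' I'.
  have [|/not_has_PAP[J [Jid JA JnP]]] := pselect (has_PA A); first by left.
  right; apply: (uncovered_proper Jid JA JnP) => P AP _ [n [t [a [ta ->]]]].
  have /idealP[P0 PD _] := spec_ideal P.
  elim/big_ind: _ => // i _; have [[_ _ tnP] ai] := ta i.
  exact: (V_Ann (tnP P AP)) ai.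
- by move=> dim0 A; exact: zero_dimensional_compact_PA.
Qed.
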